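(* Let $F$ be a field and let $L$ be a Lie algebra over $F$ whose dimension over $F$ is at most countable. If $\dim_F(L') \leq 3$, then $L' = [L,L]$; that is, every element of the derived algebra $L'$ is of the form $[x,y]$ for some $x,y\in L$.
   Context: For a Lie algebra $L$ over $F$, $[L,L] := \{[x,y] : x,y\in L\}$ denotes the set of commutators (not its span), and $L'$ denotes the derived Lie algebra, i.e. the $F$-linear span of $[L,L]$. *)

(* Defs.v *)
From HB Require Import structures.
From mathcomp Require Import all_boot all_order all_algebra.
From mathcomp Require Import boolp classical_sets functions cardinality.

Set Implicit Arguments.
Unset Strict Implicit.
Unset Printing Implicit Defensive.

Import GRing.Theory.

Local Open Scope classical_set_scope.
Local Open Scope ring_scope.

HB.mixin Record Lmodule_isLieAlgebra (F : fieldType) L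
    of GRing.Lmodule F L := {
  lie : L -> L -> L;
  lie_linearl : forall y : L, linear (lie^~ y);
  lie_linearr : forall x : L, linear (lie x);
  (* alternating rather than antisymmetric, for characteristic 2 *)
  liexx : forall x : L, lie x x = 0;
  lie_jacobi : forall x y z : L,
    lie x (lie y z) + lie y (lie z x) + lie z (lie x y) = 0
}.

#[short(type="lieAlgType")]
HB.structure Definition LieAlgebra (F : fieldType) :=
  { L of GRing.Lmodule F L & Lmodule_isLieAlgebra F L }.

Section LinearSpan.
Variables (F : fieldType) (V : lmodType F).
Implicit Types (A B W : set V).

Definition lin_span A : set V :=
  [set v | exists (s : seq V) (c : V -> F),
     (forall u, u \in s -> A u) /\ v = \sum_(u <- s) c u *: u].

Definition lin_indep B : Prop :=
  forall (s : seq V) (c : V -> F),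
    uniq s -> (forall u, u \in s -> B u) ->
    \sum_(u <- s) c u *: u = 0 -> forall u, u \in s -> c u = 0.

(* The elements of B need not be required to lie in W: B `<=` lin_span B. *)
Definition is_basis W B : Prop := lin_indep B /\ lin_span B = W.

Definition countable_dim W : Prop := exists2 B, is_basis W B & countable B.

Definition dim_le W (n : nat) : Prop :=
  exists2 B, is_basis W B & (B #<= `I_n)%card.

End LinearSpan.

Section Commutators.
Variables (F : fieldType) (L : lieAlgType F).

Definition commutators : set L := [set z | exists x y : L, z = lie x y].

Definition derived : set L := lin_span commutators.

End Commutators.

Arguments commutators {F} L.
Arguments derived {F} L.

(* Main.v *)
(** If [z] in [L'] is not a commutator, complete it to a spanning family [e1, e2, z] of [L'] and write
[[x,y] = f(x,y) e1 + g(x,y) e2 + h(x,y) z] with alternating forms [f, g, h].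
Since no nonzero multiple of [z] is a commutator, [h(x,.)] vanishes on the
common zeros of [f(x,.)] and [g(x,.)], so it is a combination of these two
functionals, with coefficients depending on [x].  For alternating forms such a
pointwise dependence is a global one: [h = a f + b g].  Hence a nonzero
functional on [L'] kills all commutators, which is absurd.

For the globalization, choose [x0] with [f(x0,.)] and [g(x0,.)] independent and
subtract from [h] a combination of [f] and [g] so that [h(x0,.) = 0].  Comparing
the dependences at [y] and at all the [y + t x0], where [h] takes the same
value, forces [h(y,.) = 0] whenever [f(x0,y) <> 0], and such [y] span. *)
Require Import Defs.
From mathcomp Require Import all_boot all_order all_algebra.
From mathcomp Require Import boolp classical_sets functions cardinality.
From mathcomp Require Import finmap ring.

Set Implicit Arguments.
Unset Strict Implicit.
Unset Printing Implicit Defensive.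

Import GRing.Theory.
Local Open Scope ring_scope.

(** * Linear functionals and alternating forms *)

Section AlternatingForms.
Variables (F : fieldType) (V : lmodType F).

Definition functional (p : V -> F) :=
  forall a u v, p (a *: u + v) = a * p u + p v.

Lemma functional0 p : functional p -> p 0 = 0.
Proof.
by move=> pL; have := pL (-1) 0 0; rewrite scaler0 addr0 mulN1r addNr. Qed.

Lemma functionalD p u v : functional p -> p (u + v) = p u + p v.
Proof. by move=> pL; rewrite -[u]scale1r pL mul1r scale1r. Qed.

Lemma functional_comb p q a b :
  functional p -> functional q -> functional (fun v => a * p v + b * q v).
Proof. by move=> pL qL c u v; rewrite pL qL; ring. Qed.

(** A zero [v] of [p] is the difference of [u + v] and [u], both outside the kernel of [p]. *)
Lemma functional_nonvanishing_span p q u : functional p -> functional q ->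
  p u != 0 -> (forall v, p v != 0 -> q v = 0) -> forall v, q v = 0.
Proof.
move=> pL qL pu qp v; have [pv|] := eqVneq (p v) 0; last exact: qp.
have : q (u + v) = 0 by apply: qp; rewrite functionalD // pv addr0.
by rewrite functionalD // (qp u) // add0r.
Qed.

Lemma functional_ker1 p q : functional p -> functional q ->
  (forall v, p v = 0 -> q v = 0) -> exists a, forall v, q v = a * p v.
Proof.
move=> pL qL pq; have [[u pu]|p0] := pselect (exists u, p u != 0); last first.
  exists 0 => v; rewrite mul0r; apply: pq.
  by apply: contrapT => /eqP pv; apply: p0; exists v.
exists (q u / p u) => v.
have : q ((- (p v / p u)) *: u + v) = 0 by apply: pq; rewrite pL; field.
by rewrite qL => /eqP; rewrite addrC addr_eq0 => /eqP ->; field.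
Qed.

(** Composing [p2] and [q] with the projection along [u] onto the kernel of [p1] gives [p2 - r2 p1]
    and [q - rq p1], which reduces the claim to [functional_ker1]. *)
Lemma functional_ker2 p1 p2 q : functional p1 -> functional p2 -> functional q ->
  (forall v, p1 v = 0 -> p2 v = 0 -> q v = 0) ->
  exists a b, forall v, q v = a * p1 v + b * p2 v.
Proof.
move=> p1L p2L qL pq.
have [[u pu]|p0] := pselect (exists u, p1 u != 0); last first.
  have [|b qb] := @functional_ker1 p2 q p2L qL.
    move=> v; apply: pq.
    by apply: contrapT => /eqP pv; apply: p0; exists v.
  by exists 0, b => v; rewrite mul0r add0r.
pose r2 := p2 u / p1 u; pose rq := q u / p1 u.
have [|||b qb] := @functional_ker1 (fun v => 1 * p2 v + (- r2) * p1 v)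
    (fun v => 1 * q v + (- rq) * p1 v).
- exact: functional_comb.
- exact: functional_comb.
- move=> v v0.
  have : q ((- (p1 v / p1 u)) *: u + v) = 0.
    apply: pq; first by rewrite p1L; field.
    by rewrite p2L -v0 /r2; field.
  by rewrite qL => <-; rewrite /rq; field.
exists (rq - b * r2), b => v; have := qb v.
by rewrite mul1r => /(canRL (addrK _)) ->; ring.
Qed.

Definition alternating (f : V -> V -> F) :=
  [/\ forall x, functional (f x), forall y, functional (f^~ y)
    & forall x, f x x = 0].

Lemma alternatingN f x y : alternating f -> f x y = - f y x.
Proof.
case=> fr fl ff; apply/eqP; rewrite -addr_eq0; have := ff (x + y).
rewrite (functionalD _ _ (fr _)) !(functionalD _ _ (fl _)) !ff add0r addr0.
by rewrite addrC => ->.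
Qed.

Lemma alternating_comb f g a b : alternating f -> alternating g ->
  alternating (fun x y => a * f x y + b * g x y).
Proof.
move=> [fr fl ff] [gr gl gg]; split=> [x|y|x].
- exact: functional_comb.
- exact: (functional_comb a b (fl y) (gl y)).
- by rewrite ff gg !mulr0 addr0.
Qed.

(** Let [c] be the ratio at [x0]. If [f x0 v != 0], then evaluating at [x0] forces the ratio at [v]
    to be [c] as well, and such [v] span. *)
Lemma alternating_proportional f g x0 u0 : alternating f -> alternating g ->
  f x0 u0 != 0 ->
  (forall x u, f x u != 0 -> exists c, forall y, g x y = c * f x y) ->
  exists c, forall x y, g x y = c * f x y.
Proof.
move=> fA gA fu0 fg; have [c gx0] := fg _ _ fu0; exists c.
pose k x y := 1 * g x y + (- c) * f x y.
have kA : alternating k by exact: alternating_comb.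
have [fr _ _] := fA; have [kr kl _] := kA.
suff k0 x y : k x y = 0.
  by move=> x y; apply/eqP; rewrite -subr_eq0 -(k0 x y) /k mul1r mulNr.
apply: (functional_nonvanishing_span (fr x0) (kl y) fu0) => v fv.
have fvx0 : f v x0 != 0 by rewrite (alternatingN _ _ fA) oppr_eq0.
have [d gv] := fg _ _ fvx0.
have kv w : k v w = (d - c) * f v w by rewrite /k gv; ring.
have : k v x0 = 0 by rewrite (alternatingN _ _ kA) /k gx0; ring.
rewrite kv => /eqP; rewrite mulf_eq0 (negPf fvx0) orbF kv => /eqP ->.
by rewrite mul0r.
Qed.

Lemma alternating_dependent_at f g h x0 u0 y :
  alternating f -> alternating g -> alternating h ->
  f x0 u0 != 0 -> (forall c, ~ forall w, g x0 w = c * f x0 w) ->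
  (forall x, exists a b, forall w, h x w = a * f x w + b * g x w) ->
  (forall w, h x0 w = 0) -> f x0 y != 0 -> forall w, h y w = 0.
Proof.
move=> fA gA hA fu0 gNf hfg hx0 fy.
have [fr fl ff] := fA; have [gr gl gg] := gA; have [hr hl hh] := hA.
pose Q w := g x0 y * f y w - f x0 y * g y w.
pose om w := g x0 y * f x0 w - f x0 y * g x0 w.
(* The dependence at [y + t x0] kills [x0], which fixes the ratio of its two
   coefficients. *)
have hQ t : exists c, forall w, h y w = c * (Q w + t * om w).
  have [a [b hab]] := hfg (t *: x0 + y).
  have {}hab w : h y w = a * (t * f x0 w + f y w) + b * (t * g x0 w + g y w).
    by rewrite -fl -gl -hab hl hx0 mulr0 add0r.
  have ab : a * f x0 y = - b * g x0 y.
    have := hab x0; rewrite ff gg !mulr0 !add0r (alternatingN y x0 hA) hx0.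
    rewrite (alternatingN y x0 fA) (alternatingN y x0 gA) oppr0 !mulrN -opprD.
    by move/esym/eqP; rewrite oppr_eq0 addr_eq0 mulNr => /eqP.
  exists (- b / f x0 y) => w; rewrite hab /Q /om.
  have -> : a = - b * g x0 y / f x0 y by rewrite -ab; field.
  by field.
move=> w0; apply: contrapT => /eqP hyw0.
(* As [h y] is nonzero, the parameters 0 and 1 yield a linear relation between [Q] and [om]. *)
have [c0 h0] := hQ 0; have [c1 h1] := hQ 1.
have c1N0 : c1 != 0 by apply: contraNneq hyw0 => c10; rewrite h1 c10 mul0r.
have Qom w : (c0 - c1) * Q w = c1 * om w.
  have := h0 w; rewrite h1 mul0r addr0 mul1r mulrBl => <-; ring.
(* Equality would give [om = 0], making [g x0] a multiple of [f x0]. *)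
have [c01|c01] := eqVneq (c0 - c1) 0.
  apply: (gNf (g x0 y / f x0 y)) => w.
  have /esym/eqP := Qom w; rewrite c01 mul0r mulf_eq0 (negPf c1N0) /= subr_eq0.
  by move/eqP => e; rewrite mulrAC e; field.
(* For this parameter [t], [Q + t om] vanishes identically, hence so does [h y]. *)
have [c hc] := hQ (- (c1 / (c0 - c1))).
move/eqP: hyw0; apply; rewrite hc.
have -> : Q w0 = c1 / (c0 - c1) * om w0 by rewrite mulrAC -Qom; field.
by ring.
Qed.

Lemma alternating_dependent f g h :
  alternating f -> alternating g -> alternating h ->
  (forall x, exists a b, forall y, h x y = a * f x y + b * g x y) ->
  exists a b, forall x y, h x y = a * f x y + b * g x y.
Proof.
move=> fA gA hA hfg.
have [[x1 [u1 fu1]]|f0] := pselect (exists x u, f x u != 0); last first.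
  have {}f0 x y : f x y = 0.
    by apply: contrapT => /eqP fxy; apply: f0; exists x, y.
  have {}hfg x : exists b, forall y, h x y = b * g x y.
    by have [a [b hab]] := hfg x; exists b => y; rewrite hab f0 mulr0 add0r.
  have [[x1 [u1 gu1]]|g0] := pselect (exists x u, g x u != 0); last first.
    exists 0, 0 => x y; have [b ->] := hfg x; rewrite !mul0r addr0.
    suff -> : g x y = 0 by rewrite mulr0.
    by apply: contrapT => /eqP gxy; apply: g0; exists x, y.
  have [//|b hb] := alternating_proportional gA hA gu1.
  by exists 0, b => x y; rewrite hb mul0r add0r.
(* If no such [x0] exists, [g x] is a multiple of [f x] wherever [f x] is nonzero, so [g], and then
   [h], is a global multiple of [f]. *)
have [[x0 [u0 [fu0 gNf]]]|dep] := pselect (exists x0 u0,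
    f x0 u0 != 0 /\ forall c, ~ forall w, g x0 w = c * f x0 w); last first.
  have [|c gc] := alternating_proportional fA gA fu1.
    move=> x u fu; apply: contrapT => gNf; apply: dep; exists x, u.
    by split=> // c gc; apply: gNf; exists c.
  have [|d hd] := alternating_proportional fA hA fu1.
    move=> x _ _; have [a [b hab]] := hfg x; exists (a + b * c) => y.
    by rewrite hab gc; ring.
  by exists d, 0 => x y; rewrite hd mul0r addr0.
have [a0 [b0 h0]] := hfg x0; exists a0, b0.
pose k x y := 1 * h x y + (- 1) * (a0 * f x y + b0 * g x y).
have kA : alternating k by apply: alternating_comb => //; exact: alternating_comb.
suff k0 x y : k x y = 0.
  by move=> x y; apply/eqP; rewrite -subr_eq0 -(k0 x y) /k mul1r mulN1r.
have [fr _ _] := fA; have [_ kl _] := kA.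
apply: (functional_nonvanishing_span (fr x0) (kl y) fu0) => v fv.
apply: (alternating_dependent_at fA gA kA fu0 gNf _ _ fv) => [z|w].
  have [a [b hab]] := hfg z; exists (a - a0), (b - b0) => w.
  by rewrite /k hab; ring.
by rewrite /k h0; ring.
Qed.

End AlternatingForms.

(** * Linear spans and coordinates *)

Section Coordinates.
Variables (F : fieldType) (V : lmodType F).
Local Open Scope classical_set_scope.

(** Linearity is asked on [W] only: coordinates are chosen there and are unconstrained elsewhere. *)
Definition functional_on (W : set V) (p : V -> F) :=
  forall a u v, W u -> W v -> p (a *: u + v) = a * p u + p v.

Lemma functional_on_comb W p q a b : functional_on W p -> functional_on W q ->
  functional_on W (fun v => a * p v + b * q v).
Proof. by move=> pL qL c u v Wu Wv; rewrite pL // qL //; ring. Qed.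

(** The list [t] may repeat vectors; the coefficients of equal entries add up. *)
Lemma sum_subseq_coeffs (s t : seq V) (c : V -> F) : uniq s -> {subset t <= s} ->
  exists d, \sum_(u <- t) c u *: u = \sum_(u <- s) d u *: u.
Proof.
move=> s_uniq; elim: t => [_|v t IHt vts].
  by exists (fun=> 0); rewrite big_nil big1 // => u _; rewrite scale0r.
have [|d dE] := IHt; first by move=> u ut; apply: vts; rewrite inE ut orbT.
have vs : v \in s by apply: vts; rewrite inE eqxx.
exists (fun u => (if u == v then c v else 0) + d u).
under [RHS]eq_bigr do rewrite scalerDl.
rewrite big_cons dE big_split /=; congr (_ + _).
rewrite (bigD1_seq v) //= eqxx big1 ?addr0 // => u /negPf ->.
by rewrite scale0r.
Qed.

(** Coordinates are chosen from expansions in a basis; they are linear because independence makes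
    these expansions unique. *)
Lemma dim_le_coordinates (W : set V) n : dim_le W n ->
  exists (e : 'I_n -> V) (k : 'I_n -> V -> F),
    (forall i, functional_on W (k i)) /\
    forall u, W u -> u = \sum_(i < n) k i u *: e i.
Proof.
case=> B [Bfree <-] Bn.
have Bfin : finite_set B by exact: card_le_finite Bn (finite_II n).
pose s : seq V := fset_set B.
have s_n : (size s <= n)%N by exact: geq_card_fset_set.
have sB u : u \in s -> B u.
  by move=> us; rewrite -[B]fset_setK.
have Bs u : B u -> u \in s by rewrite -{1}[B]fset_setK.
have s_uniq : uniq s by exact: fset_uniq.
have /choice[d dE] u : exists du : V -> F,
    lin_span B u -> u = \sum_(b <- s) du b *: b.
  have [[t [c [tB ->]]]|Nu] := pselect (lin_span B u); last first.
    by exists (fun=> 0).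
  have [|d dE] := sum_subseq_coeffs c s_uniq (t := t); first by move=> b /tB /Bs.
  by exists d.
have W_lin a u v : lin_span B u -> lin_span B v -> lin_span B (a *: u + v) /\
    forall b, b \in s -> d (a *: u + v) b = a * d u b + d v b.
  move=> Wu Wv.
  have uvE : a *: u + v = \sum_(b <- s) (a * d u b + d v b) *: b.
    rewrite {1}(dE u Wu) {1}(dE v Wv) scaler_sumr -big_split /=.
    by apply: eq_bigr => b _; rewrite scalerDl scalerA.
  have Wuv : lin_span B (a *: u + v).
    by exists s, (fun b => a * d u b + d v b); split.
  split=> // b bs; apply/eqP; rewrite -subr_eq0; apply/eqP.
  apply: (Bfree s (fun b => d (a *: u + v) b - (a * d u b + d v b))) => //.
  under eq_bigr do rewrite scalerBl.
  by rewrite sumrB -uvE -dE // subrr.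
(* A basis with fewer than [n] vectors is padded by the default 0 of [nth], with zero coordinates,
   so [e] need not be independent. *)
exists (fun i => s`_i), (fun i u => if (i < size s)%N then d u s`_i else 0).
split=> [i a u v Wu Wv|u Wu].
  case: ifP => [i_s|_]; last by rewrite mulr0 addr0.
  by have [_ ->] := W_lin a u v Wu Wv; last exact: mem_nth.
rewrite {1}(dE u Wu) (big_nth 0) big_mkord.
rewrite (big_ord_widen n (fun i => d u s`_i *: s`_i) s_n) big_mkcond /=.
by apply: eq_bigr => i _; case: ifP; rewrite ?scale0r.
Qed.

Lemma functional_on_span_eq0 (A : set V) p : functional_on (lin_span A) p ->
  (forall u, A u -> p u = 0) -> forall u, lin_span A u -> p u = 0.
Proof.
move=> pL pA _ [s [c [sA ->]]].
have spanA t : {subset t <= s} -> lin_span A (\sum_(u <- t) c u *: u).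
  by move=> ts; exists t, c; split=> // u /ts /sA.
have subA v : A v -> lin_span A v.
  move=> Av; exists [:: v], (fun=> 1); split; last by rewrite big_seq1 scale1r.
  by move=> u; rewrite inE => /eqP ->.
(* The induction runs over lists with entries in the fixed [s], so that all partial sums stay in the
   span. *)
suff : {subset s <= s} -> p (\sum_(u <- s) c u *: u) = 0 by exact.
elim: {-2}s => [_|v t IHt vts].
  rewrite big_nil.
  have W0 : lin_span A 0 by have := spanA [::]; rewrite big_nil; apply.
  by have := pL (-1) _ _ W0 W0; rewrite scaler0 addr0 mulN1r addNr.
have ts : {subset t <= s} by move=> u ut; apply: vts; rewrite inE ut orbT.
have Av : A v by apply/sA/vts; rewrite inE eqxx.
rewrite big_cons pL ?IHt ?pA ?mulr0 ?addr0 //; [exact: subA | exact: spanA].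
Qed.

End Coordinates.

(** * Commutators in the derived algebra *)

Section Commutators.
Variables (F : fieldType) (L : lieAlgType F).

Lemma lie_derived (x y : L) : derived L (lie x y).
Proof.
exists [:: lie x y], (fun=> 1); split; last by rewrite big_seq1 scale1r.
by move=> u; rewrite inE => /eqP ->; exists x, y.
Qed.

Lemma alternating_lie (k : L -> F) : functional_on (derived L) k ->
  alternating (fun x y : L => k (lie x y)).
Proof.
move=> kL.
have k0 : k 0 = 0.
  have D0 : derived L 0 by rewrite -(liexx (0 : L)); exact: lie_derived.
  by have := kL (-1) _ _ D0 D0; rewrite scaler0 addr0 mulN1r addNr.
split=> [x a u v|y a u v|x]; last by rewrite liexx.
- by rewrite lie_linearr kL //; exact: lie_derived.
- by rewrite lie_linearl kL //; exact: lie_derived.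
Qed.

(** As [k3 z != 0], the vector [z] can replace [e3] in the spanning family. *)
Lemma commutator_of_coordinates (e1 e2 e3 z : L) (k1 k2 k3 : L -> F) :
  functional_on (derived L) k1 -> functional_on (derived L) k2 ->
  functional_on (derived L) k3 ->
  (forall u, derived L u -> u = k1 u *: e1 + k2 u *: e2 + k3 u *: e3) ->
  derived L z -> k3 z != 0 -> commutators L z.
Proof.
move=> k1L k2L k3L kE Dz k3z; apply: contrapT => zN.
(* Coordinates with respect to [e1, e2, z]. *)
pose m1 u := 1 * k1 u + (- (k1 z / k3 z)) * k3 u.
pose m2 u := 1 * k2 u + (- (k2 z / k3 z)) * k3 u.
have m1L : functional_on (derived L) m1 by exact: functional_on_comb.
have m2L : functional_on (derived L) m2 by exact: functional_on_comb.
have m1z : m1 z = 0 by rewrite /m1; field.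
have m2z : m2 z = 0 by rewrite /m2; field.
have mz u : derived L u -> m1 u = 0 -> m2 u = 0 -> u = (k3 u / k3 z) *: z.
  move=> Du m1u m2u; rewrite {1}(kE u Du) [X in _ = _ *: X](kE z Dz).
  rewrite !scalerDr !scalerA.
  congr (_ *: _ + _ *: _ + _ *: _); last by field.
  - by apply/eqP; rewrite -subr_eq0 -m1u /m1; apply/eqP; field.
  - by apply/eqP; rewrite -subr_eq0 -m2u /m2; apply/eqP; field.
have m1A := alternating_lie m1L; have m2A := alternating_lie m2L.
have k3A := alternating_lie k3L.
have [|a [b abE]] := alternating_dependent m1A m2A k3A.
  move=> x; have [m1x _ _] := m1A; have [m2x _ _] := m2A; have [k3x _ _] := k3A.
  apply: (functional_ker2 (m1x x) (m2x x) (k3x x)) => y m1xy m2xy.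
  (* Otherwise [lie x y] is a nonzero multiple of [z], and rescaling [y] gives [z] itself. *)
  apply: contrapT => /eqP k3xy; apply: zN.
  exists x, ((k3 z / k3 (lie x y)) *: y).
  have lieZ c : lie x (c *: y) = c *: lie x y.
    have lie0 : lie x 0 = 0.
      by have := lie_linearr x (-1) 0 0; rewrite scaler0 addr0 scaleN1r addNr.
    by rewrite -[c *: y]addr0 lie_linearr lie0 addr0.
  rewrite lieZ {2}(mz _ (lie_derived x y) m1xy m2xy) scalerA.
  rewrite (_ : _ * _ = 1) ?scale1r //; field.
  by rewrite k3z k3xy.
(* This functional kills every commutator, hence all of [derived L], but its value at [z] is
   [k3 z]. *)
pose p u := 1 * k3 u + (-1) * (a * m1 u + b * m2 u).
have pL : functional_on (derived L) p.
  by apply: functional_on_comb => //; exact: functional_on_comb.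
have : p z = 0.
  apply: (functional_on_span_eq0 pL) => // _ [x [y ->]].
  by rewrite /p abE; ring.
by move/eqP; rewrite /p m1z m2z !mulr0 addr0 mulr0 addr0 mul1r (negPf k3z).
Qed.

End Commutators.

Theorem theorem1p1 (F : fieldType) (L : lieAlgType F)
    (hL : countable_dim [set: L]%classic)
    (hL' : dim_le (derived L) 3) :
  derived L = commutators L.
Proof.
apply/seteqP; split=> [z Dz|_ [x [y ->]]]; last exact: lie_derived.
have [e [k [kL ksum]]] := dim_le_coordinates hL'.
pose i0 : 'I_3 := ord0.
pose i1 : 'I_3 := lift ord0 ord0.
pose i2 : 'I_3 := lift ord0 (lift ord0 ord0).
have kE u : derived L u -> u = k i0 u *: e i0 + k i1 u *: e i1 + k i2 u *: e i2.
  by move=> /ksum {1}->; rewrite !big_ord_recl big_ord0 addr0 addrA.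
(* Any nonzero coordinate of [z] can serve as the third one; if all vanish, [z = 0]. *)
have [k2|] := eqVneq (k i2 z) 0; last first.
  exact: (commutator_of_coordinates (kL i0) (kL i1) (kL i2) kE Dz).
have [k1|] := eqVneq (k i1 z) 0; last first.
  apply: (commutator_of_coordinates (kL i0) (kL i2) (kL i1) _ Dz) => u Du.
  by rewrite addrAC; exact: kE.
have [k0|] := eqVneq (k i0 z) 0; last first.
  apply: (commutator_of_coordinates (kL i2) (kL i1) (kL i0) _ Dz) => u Du.
  by rewrite addrC addrA addrAC; exact: kE.
have -> : z = lie (0 : L) 0.
  by rewrite liexx (kE z Dz) k0 k1 k2 !scale0r !addr0.
by exists 0, 0.
Qed.
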